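(* Let $\alpha$ and $\beta$ be non-zero complex numbers. Any non-trivial solution $(p,q)$ to $$( * )\qquad p(u)q(u)=p(u+\beta)q(u+\alpha),$$ in which $p,q\in\mathbb{C}[u]$ are non-zero and monic, can be written as $$(p,q)=(p_1,q_1)(p_2,q_2)\cdots (p_r,q_r)$$ where $r\in\mathbb{Z}_{\ge 0}$ and each $(p_i,q_i)$ is an irreducible solution to $( * )$.
   Context: Products of pairs are componentwise, $(f,g)(p,q)=(fp,gq)$ in the ring $\mathbb{C}[u]\times\mathbb{C}[u]$. The solution $(1,1)$ of $( * )$ is called trivial. A non-trivial solution $(p,q)$ to $( * )$ in which $p$ and $q$ are non-zero and monic is called irreducible if whenever $(p,q)=(p_1,q_1)(p_2,q_2)$, where $(p_i,q_i)\in\mathbb{C}[u]\times\mathbb{C}[u]$ solves $( * )$ for $i\in\{1,2\}$, either $p_1$ and $q_1$ are constant or $p_2$ and $q_2$ are constant. *)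

(* Defs.v *)
From mathcomp Require Export all_boot all_order all_algebra.
From mathcomp Require Export reals.
From mathcomp Require Export complex.
Set Implicit Arguments.
Unset Strict Implicit.
Unset Printing Implicit Defensive.
Import GRing.Theory.
Local Open Scope ring_scope.

Section ShiftEquation.
Variables (K : fieldType) (alpha beta : K).
Implicit Types x y z : {poly K} * {poly K}.

(* p(u) q(u) = p(u + beta) q(u + alpha): the shift of p is by beta, the shift
   of q is by alpha *)
Definition is_solution x : Prop :=
  x.1 * x.2 = (x.1 \Po ('X + beta%:P)) * (x.2 \Po ('X + alpha%:P)).

Definition nontrivial x : Prop := x <> (1, 1).

Definition nonzero_monic x : Prop :=
  [/\ x.1 != 0, x.1 \is monic, x.2 != 0 & x.2 \is monic].

Definition constant_pair x : Prop := (size x.1 <= 1)%N /\ (size x.2 <= 1)%N.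

(* y * z is the componentwise product of the product ring
   {poly K} * {poly K}; y and z range over all solutions and need not be
   monic *)
Definition irreducible_solution x : Prop :=
  [/\ is_solution x, nontrivial x, nonzero_monic x &
      forall y z, is_solution y -> is_solution z -> x = y * z ->
        constant_pair y \/ constant_pair z].

End ShiftEquation.

(* Main.v *)
(** Among all solutions, a monic non-trivial one that is not irreducible splits
    as a product of two solutions neither of which is a pair of constants.
    Dividing the components by their leading coefficients keeps them solutions,
    makes them monic, and does not change the product, because the leading
    coefficients multiply to 1.  Both factors have smaller total degree, so the
    splitting terminates. *)
Require Import Defs.
From mathcomp Require Import boolp zify.
Set Implicit Arguments.
Unset Strict Implicit.
Unset Printing Implicit Defensive.
Import GRing.Theory.
Local Open Scope ring_scope.
Local Open Scope complex_scope.

Definition monic_normal (K : fieldType) (x : {poly K} * {poly K}) :=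
  ((lead_coef x.1)^-1 *: x.1, (lead_coef x.2)^-1 *: x.2).

(** The zero polynomial has size 0, so the truncated predecessor counts it as degree 0; additivity
    therefore needs non-zero components. *)
Definition total_degree (K : fieldType) (x : {poly K} * {poly K}) : nat :=
  ((size x.1).-1 + (size x.2).-1)%N.

(** Both sides of the equation are linear in each component, so the two components can be rescaled
    independently. *)
Lemma is_solution_monic_normal (K : fieldType) (alpha beta : K) x :
  is_solution alpha beta x -> is_solution alpha beta (monic_normal x).
Proof.
rewrite /is_solution /= => sol_x.
by rewrite !comp_polyZ -!scalerAl -!scalerAr sol_x.
Qed.

Lemma monic_normal_nonzero_monic (K : fieldType) (x : {poly K} * {poly K}) :
  x.1 != 0 -> x.2 != 0 -> nonzero_monic (monic_normal x).
Proof.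
move=> x1 x2.
have normP (r : {poly K}) : r != 0 ->
    (lead_coef r)^-1 *: r != 0 /\ (lead_coef r)^-1 *: r \is monic.
  move=> r0; have lr0 : lead_coef r != 0 by rewrite lead_coef_eq0.
  by rewrite monicE lead_coefZ mulVf // scaler_eq0 invr_eq0 negb_or lr0.
by have [] := normP _ x1; have [] := normP _ x2.
Qed.

Lemma monic_normalM (K : fieldType) (x y : {poly K} * {poly K}) :
  monic_normal (x * y) = monic_normal x * monic_normal y.
Proof.
by congr pair; rewrite lead_coefM invfM -scalerAl -scalerAr scalerA.
Qed.

Lemma monic_normal_id (K : fieldType) (x : {poly K} * {poly K}) :
  nonzero_monic x -> monic_normal x = x.
Proof.
case: x => p q [_ /monicP /= p1 _ /monicP /= q1].
by rewrite /monic_normal /= p1 q1 invr1 !scale1r.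
Qed.

Lemma total_degree_monic_normal (K : fieldType) (x : {poly K} * {poly K}) :
  x.1 != 0 -> x.2 != 0 -> total_degree (monic_normal x) = total_degree x.
Proof.
by move=> x1 x2; rewrite /total_degree !size_scale // invr_eq0 lead_coef_eq0.
Qed.

Lemma total_degreeM (K : fieldType) (x y : {poly K} * {poly K}) :
  (x * y).1 != 0 -> (x * y).2 != 0 ->
  total_degree (x * y) = (total_degree x + total_degree y)%N.
Proof.
rewrite /total_degree /= !mulf_eq0 !negb_or => /andP[x1 y1] /andP[x2 y2].
rewrite !size_mul //.
(* Non-zero polynomials have positive size; writing the four sizes as successors makes every
   truncated predecessor exact. *)
move: x1 y1 x2 y2; rewrite -!size_poly_gt0.
by case: (size _) => // a; case: (size _) => // b; case: (size _) => // c;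
  case: (size _) => // d _ _ _ _; rewrite !addSn !addnS /= addnACA.
Qed.

Lemma total_degree_gt0 (K : fieldType) (x : {poly K} * {poly K}) :
  ~ constant_pair x -> (0 < total_degree x)%N.
Proof.
rewrite /constant_pair /total_degree => ncst_x; rewrite lt0n addn_eq0.
apply/negP => /andP[/eqP deg1 /eqP deg2]; apply: ncst_x; lia.
Qed.

Lemma reducible_solution_split (K : fieldType) (alpha beta : K) x :
  nonzero_monic x -> is_solution alpha beta x -> nontrivial x ->
  ~ irreducible_solution alpha beta x ->
  exists y z, [/\ x = y * z,
    nonzero_monic y /\ nonzero_monic z,
    is_solution alpha beta y /\ is_solution alpha beta z &
    (total_degree y < total_degree x)%N /\ (total_degree z < total_degree x)%N].
Proof.
move=> monic_x sol_x nontriv_x red_x.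
(* Only the last clause of [irreducible_solution] can fail for [x], and its failure yields the
   splitting classically. *)
have [y [z [sol_y sol_z def_x ncst_y ncst_z]]] : exists y z,
    [/\ is_solution alpha beta y, is_solution alpha beta z, x = y * z,
        ~ constant_pair y & ~ constant_pair z].
  apply: contrapT => nsplit; apply: red_x; split=> // y z sol_y sol_z def_x.
  apply: contrapT => /not_orP[ncst_y ncst_z].
  by apply: nsplit; exists y, z.
have [x1 _ x2 _] := monic_x.
have degM : total_degree x = (total_degree y + total_degree z)%N.
  by rewrite def_x total_degreeM // -def_x.
move: (x1) (x2); rewrite {1 2}def_x /= !mulf_eq0 !negb_or.
move=> /andP[y1 z1] /andP[y2 z2].
(* In [degM] both summands are positive, so each is strictly below the total. *)
have degy := total_degree_gt0 ncst_y; have degz := total_degree_gt0 ncst_z.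
exists (monic_normal y), (monic_normal z); split.
- by rewrite -monic_normalM -def_x monic_normal_id.
- by split; apply: monic_normal_nonzero_monic.
- by split; apply: is_solution_monic_normal.
- by rewrite !total_degree_monic_normal //; lia.
Qed.

Lemma solution_irreducible_factorization (K : fieldType) (alpha beta : K) x :
  nonzero_monic x -> is_solution alpha beta x ->
  exists s : seq ({poly K} * {poly K}), x = \prod_(y <- s) y /\
    {in s, forall y, irreducible_solution alpha beta y}.
Proof.
have [n] := ubnP (total_degree x).
elim: n x => // n IHn x deg_x monic_x sol_x.
have [-> | nontriv_x] := pselect (x = (1, 1)).
  by exists [::]; rewrite big_nil.
have [irr_x | red_x] := pselect (irreducible_solution alpha beta x).
  by exists [:: x]; rewrite big_seq1; split=> // y /[!inE] /eqP->.
have [y [z [def_x [monic_y monic_z] [sol_y sol_z] [deg_y deg_z]]]] :=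
  reducible_solution_split monic_x sol_x nontriv_x red_x.
have [|s [def_y irr_s]] := IHn y _ monic_y sol_y; first by apply: leq_trans deg_y _.
have [|t [def_z irr_t]] := IHn z _ monic_z sol_z; first by apply: leq_trans deg_z _.
exists (s ++ t); rewrite big_cat -def_y -def_z; split=> // w.
by rewrite mem_cat => /orP[/irr_s | /irr_t].
Qed.

Theorem lemma2p4 (R : realType) (alpha beta : R[i])
    (alpha_neq0 : alpha != 0) (beta_neq0 : beta != 0)
    (p q : {poly R[i]})
    (pq_monic : nonzero_monic (p, q))
    (pq_sol : is_solution alpha beta (p, q))
    (pq_nontriv : nontrivial (p, q)) :
  exists (r : nat) (f : 'I_r -> {poly R[i]} * {poly R[i]}),
    (p, q) = \prod_(i < r) f i /\
    forall i : 'I_r, irreducible_solution alpha beta (f i).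
Proof.
have [s [-> irr_s]] := solution_irreducible_factorization pq_monic pq_sol.
(* The default entry 0 is never read, since every index lies below [size s]. *)
exists (size s), (fun i => s`_i); split; first by rewrite (big_nth 0) big_mkord.
by move=> i; apply: irr_s; apply: mem_nth.
Qed.
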